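(* Let $K$ be a field with $\operatorname{char}K\ne 2$, and let $$\mathrm{det}_3=\sum_{\sigma\in\Sigma_3}\operatorname{sgn}(\sigma)\,e_{\sigma(1)}\otimes e_{\sigma(2)}\otimes e_{\sigma(3)}\in K^3\otimes K^3\otimes K^3,$$ where $e_1,e_2,e_3$ is the standard basis of $K^3$ and $\Sigma_3$ is the symmetric group on $3$ letters. Then $\operatorname{trk}(\mathrm{det}_3)=\operatorname{brk}(\mathrm{det}_3)=5$.
   Context: The tensor rank $\operatorname{trk}(T)$ of $T\in K^a\otimes K^b\otimes K^c$ is the smallest $n$ such that $T$ is a sum of $n$ pure tensors $u\otimes v\otimes w$. Let $Z_n$ be the set of tensors of tensor rank $\le n$ and $\overline Z_n$ its Zariski closure (in the affine space $K^a\otimes K^b\otimes K^c$ over $K$). The border rank $\operatorname{brk}(T)$ is the smallest $n$ such that $T\in\overline Z_n$. *)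

(* Defs.v *)
From mathcomp Require Import all_boot all_order all_fingroup all_algebra.
From mathcomp Require Import boolp.
From mathcomp Require Import mpoly.

Set Implicit Arguments.
Unset Strict Implicit.
Unset Printing Implicit Defensive.

Import GRing.Theory.
Local Open Scope ring_scope.

(* K^a (x) K^b (x) K^c in coordinates with respect to the standard bases.  The
   codomain is the regular module K^o so that the K-module structure on finite
   functions is inferred. *)
Notation tensor3 K a b c := {ffun 'I_a * 'I_b * 'I_c -> K^o}.

Section Tensors.
Variable K : fieldType.

Definition pure a b c (u : 'rV[K]_a) (v : 'rV[K]_b) (w : 'rV[K]_c) :
    tensor3 K a b c :=
  [ffun i => u 0 i.1.1 * v 0 i.1.2 * w 0 i.2].

Definition sum_of_pure a b c (T : tensor3 K a b c) (n : nat) : Prop :=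
  exists (u : 'I_n -> 'rV[K]_a) (v : 'I_n -> 'rV[K]_b) (w : 'I_n -> 'rV[K]_c),
    T = \sum_(i < n) pure (u i) (v i) (w i).

Lemma sum_of_pure_ex a b c (T : tensor3 K a b c) :
  exists n, `[< sum_of_pure T n >].
Proof.
pose J := ('I_a * 'I_b * 'I_c)%type.
exists #|{: J}|; apply/asboolP.
exists (fun i => T (enum_val i) *: delta_mx 0 (enum_val i).1.1).
exists (fun i => delta_mx 0 (enum_val i).1.2).
exists (fun i => delta_mx 0 (enum_val i).2).
rewrite -(@big_enum_val _ _ _ _ {: J}
  (fun j => pure (T j *: delta_mx 0 j.1.1) (delta_mx 0 j.1.2) (delta_mx 0 j.2))).
apply/ffunP => -[[x y] z]; rewrite sum_ffunE (bigD1 (x, y, z)) //=.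
rewrite big1 ?addr0 => [|[[x' y'] z'] neq].
  by rewrite !ffunE !mxE !eqxx !mulr1.
rewrite !ffunE !mxE /= (eq_sym x) (eq_sym y) (eq_sym z).
move: neq; rewrite !xpair_eqE.
by do 3!case: (_ == _) => //=; rewrite ?(mulr0, mul0r).
Qed.

Definition trk a b c (T : tensor3 K a b c) : nat := ex_minn (sum_of_pure_ex T).

Definition Z a b c (n : nat) (T : tensor3 K a b c) : Prop := (trk T <= n)%N.

(* Zariski closure inside the set K^I of K-rational points: the common zeros of
   all polynomials over K, in variables indexed by I, that vanish on S. *)
Definition zariski_closure (I : finType) (S : {ffun I -> K^o} -> Prop)
    (x : {ffun I -> K^o}) : Prop :=
  forall p : {mpoly K[#|I|]},
    (forall y, S y -> p.@[fun k => y (enum_val k)] = 0) ->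
    p.@[fun k => x (enum_val k)] = 0.

Lemma closure_Z_ex a b c (T : tensor3 K a b c) :
  exists n, `[< zariski_closure (@Z a b c n) T >].
Proof. by exists (trk T); apply/asboolP => p; apply; apply: leqnn. Qed.

Definition brk a b c (T : tensor3 K a b c) : nat := ex_minn (closure_Z_ex T).

Definition e (n : nat) (i : 'I_n) : 'rV[K]_n := delta_mx 0 i.

Definition det3 : tensor3 K 3 3 3 :=
  \sum_(s : 'S_3)
    (-1) ^+ s *: pure (e (s 0)) (e (s 1)) (e (s ord_max)).

End Tensors.

Arguments det3 K : clear implicits.

(* Main.v *)
Require Import Defs.
From mathcomp Require Import all_boot all_order all_fingroup all_algebra.
From mathcomp Require Import boolp mpoly ring.
Import GRing.Theory.

Local Open Scope ring_scope.

(** Since [brk T <= trk T] for every tensor, it is enough to write [det3] as a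
    sum of five pure tensors and to show that its border rank is at least five.

    The upper bound is Derksen's decomposition of [det3], which has a factor
    1/2 ([det3_sum_of_pure]).

    The lower bound comes from a Koszul flattening.  Contracting T with the
    Levi-Civita symbol along the first factor turns T into a 9 x 9 matrix
    [koszul T]: it represents the map from A (x) B to (Lambda^2 A) (x) C that T,
    seen as a map from B to A (x) C (the standard bases identify spaces with
    their duals), induces by wedging with A.  On a pure tensor u (x) v (x) w
    this map factors through the cross product with u, which kills u and hence
    has rank at most 2 ([koszul_pure_rank]).  So T of tensor rank n gives
    [koszul T] of rank at most 2n, and for n <= 4 its determinant vanishes.
    This determinant is a polynomial in the entries of T, so it also vanishes
    on the Zariski closure of the tensors of rank at most 4.

    For [det3], the identity contracting two Levi-Civita symbols shows that
    [koszul det3] is the map X |-> (tr X) I - X^T on 3 x 3 matrices.  If X is in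
    its kernel, then X is scalar and tr X = 3 tr X, so that 2 tr X = 0 and, the
    characteristic not being 2, X = 0 ([koszul_det3_unit]).  The determinant
    is thus nonzero at [det3], and its border rank is at least 5. *)

(** * The Levi-Civita symbol *)

(** The Levi-Civita symbol, with indices in Z/3: the even permutations of
    (0, 1, 2) are the triples (i, i + 1, i - 1), and the odd ones are the
    triples (i, i - 1, i + 1). *)
Definition eps (R : pzRingType) (i j k : 'I_3) : R :=
  ((j == i + 1) && (k == i - 1))%:R - ((j == i - 1) && (k == i + 1))%:R.

Lemma sum_ord3 {V : nmodType} (F : 'I_3 -> V) :
  \sum_i F i = F 0 + F 1 + F (-1).
Proof.
rewrite !big_ord_recl big_ord0 addr0 addrA; congr (F _ + F _ + F _);
  exact: val_inj.
Qed.

Lemma ord3_ind (P : 'I_3 -> Prop) : P 0 -> P 1 -> P (-1) -> forall i, P i.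
Proof.
move=> P0 P1 P2 [[|[|[|//]]] lt_i3];
  [have -> // : Ordinal lt_i3 = 0 | have -> // : Ordinal lt_i3 = 1
   | have -> // : Ordinal lt_i3 = -1]; exact: val_inj.
Qed.

Lemma eps_contract (R : pzRingType) (a b c d : 'I_3) :
  \sum_k eps R k a d * eps R k b c
    = (a == b)%:R * (d == c)%:R - (a == c)%:R * (d == b)%:R.
Proof.
rewrite sum_ord3 /eps.
by move: a b c d; do 4!elim/ord3_ind;
  rewrite /= ?(oppr0, subr0, sub0r, mulr0, mul0r, mulr1, mulrN, mulNr, opprK,
               addr0, add0r, subrr).
Qed.

(** The cross product of x with itself is zero. *)
Lemma eps_isotropic {R : comPzRingType} (x : 'I_3 -> R) (d : 'I_3) :
  \sum_a x a * (\sum_k eps R k a d * x k) = 0.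
Proof. by rewrite !sum_ord3 /eps; elim/ord3_ind: d => /=; ring. Qed.

Lemma det3E (K : fieldType) (i j k : 'I_3) : det3 K (i, j, k) = eps K i j k.
Proof.
(* The coordinate is the Leibniz expansion of the determinant of the matrix
   with rows e_i, e_j and e_k. *)
pose A : 'M[K]_3 := \matrix_(m, n) (n == tnth [tuple i; j; k] m)%:R.
transitivity (\det A).
  rewrite sum_ffunE; apply: eq_bigr => s _; rewrite !ffunE /= !mxE /=.
  rewrite !big_ord_recl big_ord0 mulr1 !mxE !(tnth_nth 0) /= !(eq_sym (s _)).
  have -> : lift ord0 (lift ord0 ord0) = ord_max :> 'I_3 by exact: val_inj.
  have -> : lift ord0 ord0 = 1 :> 'I_3 by exact: val_inj.
  by rewrite -[_ *: _]/(_ * _) !mulrA.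
rewrite (expand_det_row _ 0) sum_ord3 /cofactor !(expand_det_row _ ord0).
rewrite !big_ord_recl !big_ord0 /cofactor !det_mx11 !mxE !(tnth_nth 0) /=.
by rewrite /eps; move: i j k {A}; do 3!elim/ord3_ind => /=; ring.
Qed.

(** * Upper bound *)

(** With x, y, z the standard basis, twice [det3] is
    (z+y)(x-y)(x+y) + (x+y)(y-z)(y+z) + 2y(z-x)(z+x)
    + (z-y)(y+x)(y-x) + (x-y)(z+y)(z-y). *)
Lemma det3_sum_of_pure {K : fieldType} :
  2%:R != 0 :> K -> sum_of_pure (det3 K) 5.
Proof.
move=> two_neq0.
pose x : 'rV[K]_3 := e K 0; pose y : 'rV[K]_3 := e K 1.
pose z : 'rV[K]_3 := e K (-1).
pose u := [tuple z + y; x + y; 2%:R *: y; z - y; x - y].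
pose v := [tuple x - y; y - z; z - x; y + x; z + y].
pose w := [tuple x + y; y + z; z + x; y - x; z - y].
exists (fun i => 2%:R^-1 *: tnth u i), (tnth v), (tnth w).
apply/ffunP => -[[i j] k]; rewrite det3E sum_ffunE !big_ord_recl big_ord0 addr0.
rewrite !ffunE /= !(tnth_nth 0) /= !mxE /eps /=.
by move: i j k; do 3!elim/ord3_ind => /=; field.
Qed.

(** * The Koszul flattening *)

(** Row (a, b) stands for e_a (x) e_b, and column (d, c) for e_d (x) e_c, where
    e_d is identified with a basis vector of the exterior square.  The base
    ring is arbitrary so that the flattening of the generic tensor, with
    polynomial entries, is also covered. *)
Definition koszul {R : comNzRingType} (t : 'I_3 * 'I_3 * 'I_3 -> R) :
    'M[R]_#|{: 'I_3 * 'I_3}| :=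
  \matrix_(i, j) \sum_k
    eps R k (enum_val i).1 (enum_val j).1 * t (k, (enum_val i).2, (enum_val j).2).

Lemma koszul_map {R S : comNzRingType} (f : {rmorphism R -> S})
    (t : 'I_3 * 'I_3 * 'I_3 -> R) :
  map_mx f (koszul t) = koszul (f \o t).
Proof.
apply/matrixP => i j; rewrite !mxE rmorph_sum; apply: eq_bigr => k _.
by rewrite rmorphM rmorphB !rmorph_nat.
Qed.

Lemma koszul_sum {K : fieldType} n (t : 'I_n -> tensor3 K 3 3 3) :
  koszul (\sum_i t i) = \sum_i koszul (t i).
Proof.
apply/matrixP => i j; rewrite summxE !mxE.
under [RHS]eq_bigr do rewrite mxE.
rewrite exchange_big; apply: eq_bigr => k _.
by rewrite sum_ffunE mulr_sumr.
Qed.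

(** The flattening of u (x) v (x) w is the composite of the contraction with v,
    of the cross product U with u, and of the tensor product with w; and U has
    rank at most 2 because u is in its kernel. *)
Lemma koszul_pure_rank {K : fieldType} (u v w : 'rV[K]_3) :
  (\rank (koszul (pure u v w)) <= 2)%N.
Proof.
pose U : 'M[K]_3 := \matrix_(a, d) \sum_k eps K k a d * u 0 k.
pose P : 'M[K]_(#|{: 'I_3 * 'I_3}|, 3) :=
  \matrix_(i, a) (((enum_val i).1 == a)%:R * v 0 (enum_val i).2).
pose Q : 'M[K]_(3, #|{: 'I_3 * 'I_3}|) :=
  \matrix_(d, j) ((d == (enum_val j).1)%:R * w 0 (enum_val j).2).
have -> : koszul (pure u v w) = P *m U *m Q.
  apply/matrixP => i j; rewrite !(sum_ord3, mxE) !ffunE /=.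
  case: (enum_val i) (enum_val j) => [a b] [d c] /=.
  by elim/ord3_ind: a; elim/ord3_ind: d => /=; ring.
apply: leq_trans (mxrankM_maxl _ _) _; apply: leq_trans (mxrankM_maxr _ _) _.
have uU0 : u *m U = 0.
  apply/rowP => d; rewrite !mxE -[RHS](eps_isotropic (u 0) d).
  by apply: eq_bigr => a _; rewrite mxE.
have [u0 | u_neq0] := eqVneq u 0.
  suff -> : U = 0 by rewrite mxrank0.
  by apply/matrixP => a d; rewrite !mxE big1 // => k _; rewrite u0 mxE mulr0.
rewrite -ltnS ltn_neqAle rank_leq_row andbT; apply: contra u_neq0 => freeU.
by apply/eqP/(row_free_inj freeU); rewrite uU0 mul0mx.
Qed.

Lemma koszul_rank {K : fieldType} (T : tensor3 K 3 3 3) :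
  (\rank (koszul T) <= 2 * trk T)%N.
Proof.
rewrite /trk; case: ex_minnP => n /asboolP [u [v [w ->]]] _.
have -> : (2 * n = \sum_(i < n) 2)%N by rewrite sum_nat_const card_ord mulnC.
rewrite koszul_sum.
elim/big_ind2: _ => [|A a B b leA leB|i _]; first by rewrite mxrank0.
  exact: leq_trans (mxrank_add _ _) (leq_add leA leB).
exact: koszul_pure_rank.
Qed.

Lemma koszul_det_eq0 {K : fieldType} (T : tensor3 K 3 3 3) :
  (trk T <= 4)%N -> \det (koszul T) = 0.
Proof.
move=> le_T4; apply/eqP.
rewrite -[_ == 0]negbK -unitfE -unitmxE -row_full_unit /row_full neq_ltn.
rewrite (leq_ltn_trans (koszul_rank T)) // card_prod card_ord.
by rewrite (leq_trans (n := (2 * 4).+1)) // ltnS leq_mul2l.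
Qed.

(** The witness is the determinant of the flattening of the generic tensor. *)
Lemma koszul_det_polynomial (K : fieldType) :
  exists p : {mpoly K[#|{: 'I_3 * 'I_3 * 'I_3}|]},
    forall T : tensor3 K 3 3 3,
      p.@[fun k => T (enum_val k)] = \det (koszul T).
Proof.
exists (\det (koszul (fun i => 'X_(enum_rank i)))) => T.
rewrite -det_map_mx koszul_map; congr (\det _).
apply/matrixP => i j; rewrite !mxE; apply: eq_bigr => k _.
by rewrite /= mevalXU enum_rankK.
Qed.

Lemma sum_pair_val {V : nmodType} (F : 'I_3 * 'I_3 -> V) :
  \sum_(i < #|{: 'I_3 * 'I_3}|) F (enum_val i) = \sum_b \sum_a F (a, b).
Proof.
rewrite exchange_big pair_bigA -(@big_enum_val _ _ _ _ {: 'I_3 * 'I_3} F) /=.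
by apply: eq_big => -[].
Qed.

Lemma koszul_det3_unit {K : fieldType} :
  2%:R != 0 :> K -> koszul (det3 K) \in unitmx.
Proof.
move=> two_neq0; rewrite -row_free_unit; apply/inj_row_free => x xM0.
(* X is the vector x of the kernel, read as a 3 x 3 matrix; XE says that
   (tr X) I = X^T. *)
pose X (ab : 'I_3 * 'I_3) := x 0 (enum_rank ab).
have XE c d : (\sum_a X (a, a)) * (d == c)%:R = X (c, d).
  pose G ab :=
    X ab * ((ab.1 == ab.2)%:R * (d == c)%:R - (ab.1 == c)%:R * (d == ab.2)%:R).
  have : \sum_(i < #|{: 'I_3 * 'I_3}|) G (enum_val i) = 0.
    move/matrixP/(_ 0 (enum_rank (d, c))): xM0; rewrite !mxE => xM0.
    rewrite -[RHS]xM0; apply: eq_bigr => i _.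
    rewrite /G /X enum_valK mxE enum_rankK /= -eps_contract.
    by congr (_ * _); apply: eq_bigr => k _; rewrite det3E.
  rewrite sum_pair_val /G !sum_ord3 /= => G0.
  apply/eqP; rewrite -subr_eq0 -[X in _ == X]G0; apply/eqP.
  by elim/ord3_ind: c {G G0}; elim/ord3_ind: d => /=; ring.
have trX0 : \sum_a X (a, a) = 0.
  (* The traces of the two sides of XE are 3 tr X and tr X. *)
  have := sum_ord3 (fun c => X (c, c)); rewrite -!XE !eqxx !mulr1.
  move: (\sum_a _) => t t3; apply: (mulfI two_neq0).
  have -> : 2%:R * t = (t + t + t) - t by ring.
  by rewrite -t3 subrr mulr0.
apply/rowP => i; rewrite mxE -[i]enum_valK; case: (enum_val i) => c d.
by rewrite -/(X (c, d)) -XE trX0 mul0r.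
Qed.

(** * The border rank *)

Lemma brk_le_trk {K : fieldType} {a b c} (T : tensor3 K a b c) :
  (brk T <= trk T)%N.
Proof.
rewrite {1}/brk; case: ex_minnP => n _; apply.
by apply/asboolP => p; apply; apply: leqnn.
Qed.

Lemma brk_det3_ge5 {K : fieldType} :
  2%:R != 0 :> K -> (5 <= brk (det3 K))%N.
Proof.
move=> two_neq0; rewrite /brk; case: ex_minnP => n /asboolP closure_n _.
rewrite leqNgt; apply/negP => lt_n5.
have [p pE] := koszul_det_polynomial K.
have := koszul_det3_unit two_neq0.
rewrite unitmxE unitfE -pE closure_n ?eqxx // => T le_Tn.
by rewrite pE koszul_det_eq0 // (leq_trans le_Tn).
Qed.

Theorem corollary1p12 (K : fieldType) (charK : 2%N \notin [pchar K]) :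
  trk (det3 K) = 5%N /\ brk (det3 K) = 5%N.
Proof.
have two_neq0 : 2%:R != 0 :> K.
  by apply: contra charK => /eqP two0; apply/andP; split=> //; apply/eqP.
have trk_le5 : (trk (det3 K) <= 5)%N.
  rewrite /trk; case: ex_minnP => n _; apply.
  exact/asboolP/det3_sum_of_pure.
have brk_ge5 := brk_det3_ge5 two_neq0; have le_bt := brk_le_trk (det3 K).
split; apply/eqP; rewrite eqn_leq.
  by rewrite trk_le5 (leq_trans brk_ge5).
by rewrite brk_ge5 (leq_trans le_bt).
Qed.
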